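(* For all integers $n, b \geq 1$, $j \geq 0$, and $k \geq 2$, $$\frac{1}{k-1}\,E(O_{j,k,b}(n), D_{j,k,b}(n)) = (j+1)\,O_{j+1,k,b}(n) - j\,O_{j,k,b}(n) = (j+1)\,D_{j+1,k,b}(n) - j\,D_{j,k,b}(n).$$
   Context: A partition of a positive integer $n$ is a finite non-increasing sequence of positive integers, called parts, that sum to $n$; the empty partition is the unique partition of $0$. For integers $n,j\geq 0$ and $k,b\geq 1$: - $\mathcal{O}_{j,k,b}(n)$ is the set of partitions of $n$ with exactly $j$ different parts divisible by $kb$ (repetitions allowed), i.e. the set of distinct part sizes that occur in the partition and are divisible by $kb$ has exactly $j$ elements, with each such part allowed to occur any positive number of times. Put $O_{j,k,b}(n) = |\mathcal{O}_{j,k,b}(n)|$. - $\mathcal{D}_{j,k,b}(n)$ is the set of partitions of $n$ with exactly $j$ different parts that are both divisible by $b$ and appear at least $k$ times, i.e. there are exactly $j$ distinct part sizes $i$ with $b\mid i$ such that $i$ occurs at least $k$ times in the partition. Put $D_{j,k,b}(n) = |\mathcal{D}_{j,k,b}(n)|$. For a partition $\pi$, $\ell(\pi)$ denotes the number of parts of $\pi$, counted with multiplicity. The excess in the total number of parts is $$E(O_{j,k,b}(n), D_{j,k,b}(n)) = \sum_{\pi \in \mathcal{O}_{j,k,b}(n)} \ell(\pi) - \sum_{\pi \in \mathcal{D}_{j,k,b}(n)} \ell(\pi).$$ *)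

(* Defs.v *)
From HB Require Import structures.
From mathcomp Require Import all_boot all_order all_algebra.

Set Implicit Arguments.
Unset Strict Implicit.
Unset Printing Implicit Defensive.

Import GRing.Theory.

Definition is_partition (n : nat) (s : seq nat) : bool :=
  [&& sorted geq s, all (fun i => 0 < i) s & sumn s == n].

Record partition_of (n : nat) : predArgType := PartitionOf {
  parts :> seq nat;
  _ : is_partition n parts
}.

HB.instance Definition _ n := [isSub for @parts n].
HB.instance Definition _ n := [Countable of partition_of n by <:].

(* There are finitely many partitions of n: they embed into the sequences of
   at most n numbers in {0, ..., n}. *)
Section PartitionFinite.

Variable n : nat.
Implicit Types p : partition_of n.

Lemma size_partition p : size p <= n.
Proof.
case: p => s /= /and3P[_ s_gt0 /eqP <-].
elim: s s_gt0 => //= i s IHs /andP[i_gt0 /IHs]; rewrite -add1n; exact: leq_add.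
Qed.

Lemma partition_leq p i : i \in (p : seq nat) -> i <= n.
Proof.
case: p => s /= /and3P[_ _ /eqP <-].
elim: s => //= a s IHs; rewrite inE => /predU1P[->|/IHs le_is].
  exact: leq_addr.
exact: leq_trans le_is (leq_addl _ _).
Qed.

Lemma partition_bseq_proof p :
  size [seq inord i : 'I_n.+1 | i <- p] <= n.
Proof. by rewrite size_map size_partition. Qed.

Definition bseq_of_partition p : n.-bseq 'I_n.+1 :=
  Bseq (partition_bseq_proof p).

Definition partition_of_bseq (t : n.-bseq 'I_n.+1) : option (partition_of n) :=
  insub [seq val i | i <- t].

Lemma bseq_of_partitionK : pcancel bseq_of_partition partition_of_bseq.
Proof.
move=> p; rewrite /partition_of_bseq /= -map_comp map_id_in ?valK //.
by move=> i /partition_leq le_in /=; rewrite inordK.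
Qed.

HB.instance Definition _ : isFinite (partition_of n) := PCanIsFinite bseq_of_partitionK.

End PartitionFinite.

Section Families.

Variables (j k b n : nat).

Definition O_set : {set partition_of n} :=
  [set p : partition_of n |
     size (undup [seq i <- (p : seq nat) | k * b %| i]) == j].

Definition D_set : {set partition_of n} :=
  [set p : partition_of n |
     size (undup [seq i <- (p : seq nat) |
                    (b %| i) && (k <= count_mem i p)]) == j].

Definition O_num : nat := #|O_set|.

Definition D_num : nat := #|D_set|.

End Families.

Definition excess (n : nat) (A B : {set partition_of n}) : int :=
  ((\sum_(p in A) (size p)%:Z) - (\sum_(p in B) (size p)%:Z))%R.

(* Main.v *)
Require Import Defs.
From HB Require Import structures.
From mathcomp Require Import all_boot all_order all_algebra.
From mathcomp Require Import ring.

(** Two kinds of positive multiples i of b are marked by a partition p of n: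
    an O-mark is an i such that k * i is a part of p, a D-mark is an i that
    occurs at least k times in p.  Since i |-> k * i turns O-marks into the part
    sizes divisible by k * b, the families of the theorem consist of the
    partitions with exactly j O-marks, respectively exactly j D-marks.

    Exact numbers of marks are hard to compare, but pairs (p, S) with S a set
    of marks of p are easy: given S, replacing for each i in S one part k * i
    by k parts i is a bijection from the partitions in which all of S is
    O-marked onto those in which all of S is D-marked, and it raises the
    number of parts by (k - 1) * #|S| ([exchange_marks]).  The marks outside of
    S may change in the process, but the pairs do not record them.

    Generating functions pass between the two kinds of counts.  As
    X ^ #|A| is the sum of (X - 1) ^ #|S| over the subsets S of A, the sum
    over p of w(p) X ^ (number of marks of p) is the sum over S of
    (X - 1) ^ #|S| times the sum of w(p) over the p in which S is marked
    ([gf_subsets]).  Let G be this polynomial for w = 1 and O-marks.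

    - With w = 1 the exchange shows that D-marks give the same G ([gf_count]),
      whose coefficients are O_j = D_j.
    - With w the number of parts, the D-polynomial exceeds the O-polynomial by
      (k - 1) times the sum of #|S| (X - 1) ^ #|S| over the marked pairs, that
      is by (k - 1) (X - 1) G' ([gf_length]).

    The coefficient of X^j in (X - 1) G' is j O_j - (j + 1) O_(j+1), which is
    the theorem after a change of sign ([excess_O_num]). *)

Set Implicit Arguments.
Unset Strict Implicit.
Unset Printing Implicit Defensive.

Import GRing.Theory Num.Theory.

(** * Partitions containing a given multiset of parts *)

Definition submultiset (s t : seq nat) : bool :=
  all (fun x => count_mem x s <= count_mem x t) s.

Lemma submultisetP (s t : seq nat) :
  reflect (exists r, perm_eq t (s ++ r)) (submultiset s t).
Proof.
apply: (iffP allP) => [le_st | [r /permP eq_t] x _]; last first.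
  by rewrite eq_t count_cat leq_addr.
have /count_subseqP[s' /perm_to_subseq[r eq_t] eq_s] :
    forall x, count_mem x s <= count_mem x t.
  move=> x; have [/le_st // | x_notin] := boolP (x \in s).
  by rewrite (count_memPn x_notin).
by exists r; rewrite (perm_trans eq_t) // perm_cat2r perm_sym.
Qed.

Lemma geq_total : total geq. Proof. by move=> x y; apply: leq_total. Qed.

Lemma geq_trans : transitive geq.
Proof. by move=> y x z /= le_yx le_zy; apply: leq_trans le_zy le_yx. Qed.

Lemma geq_anti : antisymmetric geq.
Proof. by move=> x y; rewrite /= andbC => /anti_leq. Qed.

Lemma is_partition_sort (n : nat) (s : seq nat) :
  all (fun i => 0 < i) s -> sumn s = n -> is_partition n (sort geq s).
Proof.
move=> s_gt0 sum_s; apply/and3P; split; first exact: (sort_sorted geq_total).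
  by rewrite all_sort.
by rewrite (perm_sumn (permEl (perm_sort geq s))) sum_s.
Qed.

Lemma perm_partition (n : nat) (p q : partition_of n) : perm_eq p q -> p = q.
Proof.
move=> eq_pq; apply: val_inj; case: p q eq_pq => [s /= /and3P[s_sorted _ _]].
case=> [t /= /and3P[t_sorted _ _]]; exact: (sorted_eq geq_trans geq_anti).
Qed.

Section AddParts.

Variables (n m : nat) (s : seq nat).
Hypotheses (s_gt0 : all (fun i => 0 < i) s) (sum_s : sumn s + m = n).

Lemma add_parts_proof (q : partition_of m) :
  is_partition n (sort geq (s ++ q)).
Proof.
case: q => q /= /and3P[_ q_gt0 /eqP sum_q]; apply: is_partition_sort.
  by rewrite all_cat s_gt0.
by rewrite sumn_cat sum_q.
Qed.

Definition add_parts (q : partition_of m) : partition_of n :=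
  PartitionOf (add_parts_proof q).

Lemma perm_add_parts (q : partition_of m) : perm_eq (add_parts q) (s ++ q).
Proof. by rewrite perm_sort. Qed.

Lemma add_parts_inj : injective add_parts.
Proof.
move=> q r eq_qr; apply: perm_partition; rewrite -(perm_cat2l s).
by rewrite -(permPl (perm_add_parts q)) eq_qr perm_add_parts.
Qed.

Lemma mem_add_parts (p : partition_of n) :
  (p \in [set add_parts q | q : partition_of m]) = submultiset s p.
Proof.
apply/imsetP/submultisetP => [[q _ ->] | [r eq_p]].
  by exists q; apply: perm_add_parts.
have /and3P[_ p_gt0 /eqP sum_p] : is_partition n p by case: (p).
have r_gt0 : all (fun i => 0 < i) r.
  by move: p_gt0; rewrite (perm_all _ eq_p) all_cat => /andP[].
have sum_r : sumn r = m.
  move: sum_p; rewrite (perm_sumn eq_p) sumn_cat -sum_s.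
  by move/eqP; rewrite eqn_add2l => /eqP.
exists (PartitionOf (is_partition_sort r_gt0 sum_r)) => //.
apply: perm_partition; rewrite (permPl eq_p) perm_sym.
by rewrite (permPl (perm_add_parts _)) perm_cat2l perm_sort.
Qed.

(** A partition of n that contains s is s together with an arbitrary partition
    of what remains of n. *)
Lemma sum_submultiset (V : nmodType) (F : nat -> V) :
  (\sum_(p : partition_of n | submultiset s p) F (size p) =
   \sum_(q : partition_of m) F (size s + size q)%N)%R.
Proof.
under eq_bigl => p do rewrite -mem_add_parts.
rewrite big_imset /=; last by move=> q r _ _; apply: add_parts_inj.
by apply: eq_bigr => q _; rewrite size_sort size_cat.
Qed.

End AddParts.

Lemma sumn_submultiset (n : nat) (s : seq nat) (p : partition_of n) :
  submultiset s p -> sumn s <= n.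
Proof.
case/submultisetP=> r eq_p; case: p eq_p => p /= /and3P[_ _ /eqP <-] eq_p.
by rewrite (perm_sumn eq_p) sumn_cat leq_addr.
Qed.

(** The partitions containing s and those containing t are both parametrized
    by the partitions of n - sumn s; when sumn s exceeds n both sums are
    empty. *)
Lemma exchange_parts (n c : nat) (s t : seq nat)
    (V : nmodType) (F : nat -> V) :
    all (fun i => 0 < i) s -> all (fun i => 0 < i) t -> sumn s = sumn t ->
    size t = size s + c ->
  (\sum_(p : partition_of n | submultiset t p) F (size p) =
   \sum_(p : partition_of n | submultiset s p) F (size p + c)%N)%R.
Proof.
move=> s_gt0 t_gt0 eq_st size_t.
have [le_sn | lt_ns] := leqP (sumn s) n; last first.
  by rewrite !big_pred0 // => p; apply: contraTF lt_ns => /sumn_submultiset;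
    rewrite -?eq_st -leqNgt.
rewrite (sum_submultiset s_gt0 (subnKC le_sn) (fun x => F (x + c))).
rewrite (sum_submultiset (m := n - sumn s) t_gt0) -?eq_st ?subnKC //.
by apply: eq_bigr => q _; rewrite size_t addnAC.
Qed.

(** * Marks of a partition *)

Section MarkedParts.

Variables (n b k : nat).
Hypothesis k_gt1 : 1 < k.
Implicit Types (p : partition_of n) (S : {set 'I_n}).

(** The ordinal i : 'I_n stands for the number i.+1, so that every mark is
    positive; both kinds of marks are indexed by the small part i.+1, which
    makes the exchange act on a fixed set S. *)
Definition O_marks p : {set 'I_n} :=
  [set i : 'I_n | (b %| i.+1) && (k * i.+1 \in (p : seq nat))].

Definition D_marks p : {set 'I_n} :=
  [set i : 'I_n | (b %| i.+1) && (k <= count_mem i.+1 p)].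

Lemma partition_gt0 p i : i \in (p : seq nat) -> 0 < i.
Proof. by case: p => s /= /and3P[_ /allP s_gt0 _]; apply: s_gt0. Qed.

Lemma size_O_marks p :
  size (undup [seq i <- (p : seq nat) | k * b %| i]) = #|O_marks p|.
Proof.
have k_gt0 : 0 < k by apply: ltnW.
rewrite cardE -(size_map (fun i : 'I_n => k * i.+1)).
apply/perm_size/uniq_perm; first exact: undup_uniq.
  rewrite map_inj_uniq ?enum_uniq // => i j /eqP.
  by rewrite eqn_pmul2l // => /eqP[/val_inj].
move=> x; rewrite mem_undup mem_filter.
apply/andP/mapP => [[/dvdnP[c ->] x_p] | [i]]; last first.
  by rewrite mem_enum inE => /andP[b_i i_p] ->; rewrite dvdn_pmul2l.
have := partition_gt0 x_p; have := partition_leq x_p.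
rewrite mulnCA in x_p *; case def_i: (c * b) x_p => [|i] x_p le_n //.
  by rewrite muln0.
have lt_in : i < n by apply: leq_trans le_n; rewrite leq_pmull.
by exists (Ordinal lt_in); rewrite // mem_enum inE /= x_p -def_i dvdn_mull.
Qed.

Lemma size_D_marks p :
  size (undup [seq i <- (p : seq nat) |
                 (b %| i) && (k <= count_mem i p)]) = #|D_marks p|.
Proof.
rewrite cardE -(size_map (fun i : 'I_n => i.+1)).
apply/perm_size/uniq_perm; first exact: undup_uniq.
  by rewrite map_inj_uniq ?enum_uniq // => i j [/val_inj].
move=> x; rewrite mem_undup mem_filter.
apply/andP/mapP => [[x_marked x_p] | [i]]; last first.
  rewrite mem_enum inE => i_marked ->; split=> //.
  case/andP: i_marked => _ le_k.
  by rewrite -has_pred1 has_count (leq_trans _ le_k) // ltnW.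
have := partition_gt0 x_p; have := partition_leq x_p.
case: x x_p x_marked => // i _ i_marked lt_in _.
by exists (Ordinal lt_in); rewrite // mem_enum inE.
Qed.

(** The parts that witness that all of S is O-marked, respectively D-marked. *)
Definition O_block S : seq nat := [seq k * i.+1 | i : 'I_n <- enum S].

Definition D_block S : seq nat :=
  flatten [seq nseq k i.+1 | i : 'I_n <- enum S].

Lemma O_block_gt0 S : all (fun i => 0 < i) (O_block S).
Proof. by apply/allP => x /mapP[i _ ->]; rewrite muln_gt0 ltnW. Qed.

Lemma D_block_gt0 S : all (fun i => 0 < i) (D_block S).
Proof. by apply/allP => x /flatten_mapP[i _ /nseqP[->]]. Qed.

Lemma sumn_blocks S : sumn (O_block S) = sumn (D_block S).
Proof.
rewrite sumn_flatten -map_comp; congr sumn.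
by apply: eq_map => i /=; rewrite sumn_nseq mulnC.
Qed.

Lemma size_blocks S : size (D_block S) = size (O_block S) + k.-1 * #|S|.
Proof.
rewrite size_map -cardE -mulSn prednK ?(ltnW k_gt1) // size_flatten /shape.
rewrite -map_comp cardE; elim: (enum S) => [|i s IHs] /=.
  by rewrite muln0.
by rewrite IHs size_nseq mulnS.
Qed.

Lemma sub_O_marks S p :
  (S \subset O_marks p) =
    [forall i in S, b %| (val i).+1] && submultiset (O_block S) p.
Proof.
have uniqO : uniq (O_block S).
  rewrite map_inj_uniq ?enum_uniq // => i j /eqP.
  by rewrite eqn_pmul2l ?(ltnW k_gt1) // => /eqP[/val_inj].
apply/subsetP/andP => [sub_S | [/forall_inP S_b /allP S_p] i Si].
  split; first by apply/forall_inP => i /sub_S; rewrite inE => /andP[].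
  apply/allP=> x Sx; rewrite count_uniq_mem // Sx -has_count has_pred1.
  case/mapP: Sx => i; rewrite mem_enum => /sub_S; rewrite inE.
  by case/andP=> _ i_p ->.
have Oi : k * i.+1 \in O_block S by apply: map_f; rewrite mem_enum.
rewrite inE S_b //= -has_pred1 has_count.
by have := S_p _ Oi; rewrite count_uniq_mem // Oi.
Qed.

Lemma sub_D_marks S p :
  (S \subset D_marks p) =
    [forall i in S, b %| (val i).+1] && submultiset (D_block S) p.
Proof.
have countD (i : 'I_n) : i \in S -> count_mem i.+1 (D_block S) = k.
  move=> Si; rewrite count_flatten -map_comp sumnE big_map big_enum.
  rewrite (bigD1 i) //=.
  rewrite count_nseq /= eqxx mul1n big1 ?addn0 // => j /andP[_ ne_ji].
  by rewrite count_nseq /= eqSS (inj_eq val_inj) (negPf ne_ji).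
apply/subsetP/andP => [sub_S | [/forall_inP S_b /allP S_p] i Si].
  split; first by apply/forall_inP => i /sub_S; rewrite inE => /andP[].
  apply/allP=> x /flatten_mapP[i]; rewrite mem_enum => Si /nseqP[-> _].
  by have /[!inE] /andP[_] := sub_S i Si; rewrite countD.
have Di : i.+1 \in D_block S.
  apply/flatten_mapP; exists i; first by rewrite mem_enum.
  by rewrite mem_nseq (ltnW k_gt1) eqxx.
by rewrite inE S_b //= -[k in k <= _](countD i Si) S_p.
Qed.

(** Divisibility by b is a condition on S alone, common to both kinds of marks;
    the rest of the marking condition says that p contains a block, and the two
    blocks have the same sum. *)
Lemma exchange_marks S (V : nmodType) (F : nat -> V) :
  (\sum_(p | S \subset D_marks p) F (size p) =
   \sum_(p | S \subset O_marks p) F (size p + k.-1 * #|S|)%N)%R.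
Proof.
under eq_bigl => p do rewrite sub_D_marks.
under [in RHS]eq_bigl => p do rewrite sub_O_marks.
case: [forall i in S, _] => /=; last by rewrite !big_pred0.
apply: exchange_parts (O_block_gt0 S) (D_block_gt0 S) (sumn_blocks S) _.
exact: size_blocks.
Qed.

End MarkedParts.

(** * Generating functions by number of marks *)

Local Open Scope ring_scope.

(** The binomial theorem, as the expansion of a product over A in which each
    index of a subset S contributes u and each other one contributes 1. *)
Lemma exprD1_subsets (R : comNzRingType) (I : finType) (A : {set I}) (u : R) :
  (u + 1) ^+ #|A| = \sum_(S : {set I} | S \subset A) u ^+ #|S|.
Proof.
(* A product over all of I, with u replaced by 0 outside of A, so that only
   the subsets of A contribute to the expansion. *)
transitivity (\prod_(i : I) ((if i \in A then u else 0) + 1)).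
  rewrite -prodr_const big_mkcond /=; apply: eq_bigr => i _.
  by case: ifP; rewrite ?add0r.
rewrite bigA_distr [RHS]big_mkcond; apply: eq_bigr => S _.
rewrite -big_mkcond /=; case: ifPn => [/subsetP sSA | /subsetPn[i Si nAi]].
  by rewrite -prodr_const; apply: eq_bigr => i /sSA ->.
by rewrite (bigD1 i) //= (negPf nAi) mul0r.
Qed.

(** Expanding in powers of X - 1 replaces the exact value of A p by the
    condition that A p contains S, which is the one that [exchange_marks]
    transports. *)
Lemma gf_subsets (T I : finType) (A : T -> {set I}) (w : T -> int) :
  \sum_p w p *: 'X^#|A p| =
  \sum_(S : {set I})
     (\sum_(p | S \subset A p) w p) *: ('X - 1) ^+ #|S| :> {poly int}.
Proof.
transitivity (\sum_p \sum_(S : {set I} | S \subset A p)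
                w p *: ('X - 1) ^+ #|S| : {poly int}).
  by apply: eq_bigr => p _; rewrite -scaler_sumr -exprD1_subsets subrK.
rewrite (exchange_big_dep predT) //=; apply: eq_bigr => S _.
by rewrite scaler_suml.
Qed.

Section GeneratingFunctions.

Variables (n b k : nat).
Hypothesis k_gt1 : (1 < k)%N.
Local Notation partition := (partition_of n).
Local Notation O_marks := (@O_marks n b k).
Local Notation D_marks := (@D_marks n b k).

Lemma gf_count :
  \sum_(p : partition) 1 *: 'X^#|D_marks p| =
  \sum_(p : partition) 1 *: 'X^#|O_marks p| :> {poly int}.
Proof.
rewrite !gf_subsets; apply: eq_bigr => S _; congr (_ *: _).
exact: exchange_marks (fun=> 1).
Qed.

(** The excess (k - 1) * #|S| of each exchange is what the operator
    (k - 1) (X - 1) d/dX multiplies (X - 1) ^ #|S| by. *)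
Lemma gf_length :
  \sum_(p : partition) (size p)%:Z *: 'X^#|D_marks p| =
  \sum_(p : partition) (size p)%:Z *: 'X^#|O_marks p|
  + ('X - 1) * (\sum_(p : partition) 1 *: 'X^#|O_marks p|)^`() *+ k.-1
    :> {poly int}.
Proof.
rewrite !gf_subsets raddf_sum mulr_sumr -sumrMnl -big_split.
apply: eq_bigr => S _ /=.
rewrite (exchange_marks b k_gt1 S Posz) derivZ.
under [in LHS]eq_bigr => p _ do rewrite PoszD.
rewrite big_split scalerDl /=; congr (_ + _).
have -> : \sum_(p : partition | S \subset O_marks p) (k.-1 * #|S|)%:Z
        = (\sum_(p : partition | S \subset O_marks p) 1) * (k.-1 * #|S|)%:Z.
  by rewrite mulr_suml; under [RHS]eq_bigr do rewrite mul1r.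
rewrite -scalerA -scalerAr scalerMnr; congr (_ *: _).
rewrite deriv_exp derivB derivX derivC subr0 mul1r mulrnAr -mulrnA mulnC.
rewrite -natz scaler_nat.
by case: #|S| => [|c]; rewrite ?mul0n ?mulr0n //= -exprS.
Qed.

Lemma coef_gf (A : partition -> nat) (w : partition -> int) (j : nat) :
  (\sum_p w p *: 'X^(A p))`_j = \sum_(p | A p == j) w p.
Proof. exact: coef_sumMXn. Qed.

Lemma O_numE j :
  (O_num j k b n)%:Z =
  (\sum_(p : partition) 1 *: 'X^#|O_marks p| : {poly int})`_j.
Proof.
rewrite coef_gf sumr_const natz; congr Posz; apply: eq_card => p.
by rewrite !inE size_O_marks.
Qed.

Lemma D_num_eq_O_num j : D_num j k b n = O_num j k b n.
Proof.
apply/eqP; rewrite -eqz_nat O_numE -gf_count coef_gf sumr_const natz.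
apply/eqP.
by congr Posz; apply: eq_card => p; rewrite !inE size_D_marks.
Qed.

(** This is the coefficient of X^j in - (k - 1) (X - 1) G', where G is the
    generating function of the numbers O_j. *)
Lemma excess_O_num j :
  excess (O_set j k b n) (D_set j k b n) =
  (k.-1)%:Z * ((j.+1)%:Z * (O_num j.+1 k b n)%:Z - j%:Z * (O_num j k b n)%:Z).
Proof.
rewrite /excess.
under eq_bigl => p do rewrite inE size_O_marks //.
under [X in _ - X]eq_bigl => p do rewrite inE size_D_marks //.
rewrite -!coef_gf gf_length coefD opprD addNKr.
rewrite coefMn mulrBl mul1r coefB coefXM !coef_deriv !O_numE.
move: (\sum_p _ : {poly int}) => G.
have natmulE (x : int) m : x *+ m = m%:Z * x by rewrite -mulr_natl natz.
rewrite !natmulE -mulrN; congr (_ * _).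
by case: j => [|j] /=; rewrite ?natmulE ?mul0r opprB ?subr0.
Qed.

End GeneratingFunctions.

Theorem theorem1p2 (n b j k : nat)
    (hn : (1 <= n)%N) (hb : (1 <= b)%N) (hk : (2 <= k)%N) :
  1 / (k%:Q - 1) * (excess (O_set j k b n) (D_set j k b n))%:Q
    = (j%:Q + 1) * (O_num j.+1 k b n)%:Q - j%:Q * (O_num j k b n)%:Q
  /\
  (j%:Q + 1) * (O_num j.+1 k b n)%:Q - j%:Q * (O_num j k b n)%:Q
    = (j%:Q + 1) * (D_num j.+1 k b n)%:Q - j%:Q * (D_num j k b n)%:Q.
Proof.
split; last by rewrite !D_num_eq_O_num.
rewrite excess_O_num //.
have k1_neq0 : k%:Q - 1 != 0.
  by rewrite subr_eq0 (eqr_int rat k 1) eqz_nat gtn_eqF.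
have -> : (k.-1)%:Z = k%:Z - 1 by rewrite -subn1 subzn // ltnW.
rewrite -addn1 PoszD !(rmorphM, rmorphB, rmorphD) /=.
by field.
Qed.
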